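(* For Case D with $\ell$ particles and partitions $\lambda,\nu$ with at most $\ell$ parts, $\mathsf{P}_{\le,n}(\lambda\mid\nu)=\boldsymbol{\rho}^{\lambda/\nu}\prod_{i=1}^{\ell}\prod_{j=1}^n(1+\rho_ix_j)^{-1}\cdot\det\bigl[e_{\lambda_i-\nu_j+j-i}\bigl(\mathbf{x}_n\sqcup-\boldsymbol{\rho}_{j-1}^{-1}/-\boldsymbol{\rho}_i^{-1}\bigr)\bigr]_{i,j=1}^{\ell}$.
   Context: Case D particle system: $\ell$ particles labelled $1,\dots,\ell$ on $\mathbb{Z}_{\ge0}$; $G(j,i)$ is the position of particle $j$ after time step $i$, with $G(1,i)\ge\dots\ge G(\ell,i)\ge0$, so configurations are partitions with at most $\ell$ parts. With parameters $x_1,x_2,\dots$ and $\rho_1,\dots,\rho_\ell$ ($\rho_jx_i>0$), at each time step $i$ independent Bernoulli $w_{ji}$ with $\mathsf{P}(w_{ji}=1)=\rho_jx_i/(1+\rho_jx_i)$, $\mathsf{P}(w_{ji}=0)=1/(1+\rho_jx_i)$ are drawn; particles are updated in the order $1,\dots,\ell$, particle $j$ jumping to $G(j,i-1)+w_{ji}$ and pushing to its new site every particle of smaller label to its left, so $G(j,i)=\max_{j\le m\le\ell}(G(m,i-1)+w_{mi})$. Define $\mathsf{P}_{\le,n}(\lambda\mid\nu)=\mathsf{P}(G(\ell,n)\le\lambda_\ell,\dots,G(1,n)\le\lambda_1\mid G(\cdot,0)=\nu)$. Notation: $\boldsymbol{\rho}^{\lambda/\nu}=\prod_j\rho_j^{\lambda_j-\nu_j}$;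 $\mathbf{x}_n=(x_1,\dots,x_n)$; $-\boldsymbol{\rho}_i^{-1}=(-\rho_1^{-1},\dots,-\rho_i^{-1})$. For alphabets $\mathbf{a},\mathbf{b}$, $e_m(\mathbf{a}/\mathbf{b})=\sum_{k=0}^m(-1)^{m-k}e_k(\mathbf{a})h_{m-k}(\mathbf{b})$ for $m\ge0$ and $0$ for $m<0$; $\sqcup$ is union of alphabets. *)

(* Defs.v *)
From HB Require Import structures.
From mathcomp Require Import all_boot all_order all_algebra finmap.
From mathcomp Require Import all_classical all_reals all_analysis.

Set Implicit Arguments.
Unset Strict Implicit.
Unset Printing Implicit Defensive.

Import Order.TTheory GRing.Theory Num.Theory.
Local Open Scope classical_set_scope.
Local Open Scope ring_scope.

(* Alphabets are sequences: repetitions count and the union of alphabets is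
   concatenation. *)
Definition esym (R : comNzRingType) (k : nat) (a : seq R) : R :=
  \sum_(A : {set 'I_(size a)} | #|A| == k) \prod_(i in A) a`_i.

Definition hsym (R : comNzRingType) (k : nat) (b : seq R) : R :=
  \sum_(t : k.-tuple 'I_(size b) | sorted leq (map val t)) \prod_(i <- t) b`_i.

Definition esuper (R : comNzRingType) (m : int) (a b : seq R) : R :=
  match m with
  | Posz m => \sum_(k < m.+1) (-1) ^+ (m - k) * esym k a * hsym (m - k) b
  | Negz _ => 0
  end.

(* The first k letters of (- rho_1^-1, ..., - rho_l^-1). *)
Definition neg_inv (R : fieldType) (l : nat) (rho : 'I_l -> R) (k : nat) :
    seq R :=
  take k [seq - (rho j)^-1 | j <- enum 'I_l].

Definition is_partition (l : nat) (lam : 'I_l -> nat) : Prop :=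
  forall i j : 'I_l, (i <= j)%N -> (lam j <= lam i)%N.

(* Particle labels and time steps are shifted to start at 0: [w j i] is the
   variable drawn for particle j+1 at time step i+1, whereas [G nu w j i] is
   the position of particle j+1 after i time steps, starting from [nu]. *)
Fixpoint G (l : nat) (nu : 'I_l -> nat) (w : 'I_l -> nat -> bool)
    (j : 'I_l) (i : nat) : nat :=
  if i is i'.+1 then \max_(m < l | (j <= m)%N) (G nu w m i' + w m i')%N
  else nu j.

Definition mutually_independent (d : measure_display) (T : measurableType d)
    (R : realType) (P : probability T R) (I : choiceType)
    (d' : measure_display) (S : measurableType d') (X : I -> {RV P >-> S}) :
    Prop :=
  forall (J : {fset I}) (A : I -> set S), (forall i, measurable (A i)) ->
    P (\bigcap_(i in [set` J]) (X i @^-1` A i)) =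
    (\prod_(i <- J) P (X i @^-1` A i))%E.

Definition caseD_weights (d : measure_display) (T : measurableType d)
    (R : realType) (P : probability T R) (l : nat) (rho : 'I_l -> R)
    (x : nat -> R) (w : 'I_l -> nat -> {RV P >-> bool}) : Prop :=
  [/\ forall j i, P (w j i @^-1` [set true]) =
        (rho j * x i / (1 + rho j * x i))%:E,
      forall j i, P (w j i @^-1` [set false]) = (1 + rho j * x i)^-1%:E &
      mutually_independent (fun ji : 'I_l * nat => w ji.1 ji.2)].

Definition P_le (d : measure_display) (T : measurableType d)
    (R : realType) (P : probability T R) (l : nat)
    (w : 'I_l -> nat -> {RV P >-> bool}) (n : nat) (lam nu : 'I_l -> nat) :
    \bar R :=
  P [set t | forall j : 'I_l, (G nu (fun m i => w m i t) j n <= lam j)%N].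

(* Main.v *)
(** Conditioning on the last time step, [G(j, n+1) <= lam_j] for all j means
    [G(m, n) <= lam_m - w_m] for all m, because [lam] is a partition.  The
    determinant obeys the same recursion: adding the letter [x_n] splits each
    row in two, [e_m(x, a / b) = e_m(a / b) + x e_(m-1)(a / b)], and the
    determinant is multilinear in its rows.  The bound [lam - w] may fail to be
    a partition, but only by ascents of size one, and an ascent
    [mu_(i+1) = mu_i + 1] can be levelled to [mu_(i+1) = mu_i] on both sides: in
    the probability because the particles are ordered, in the determinant by a
    row operation using
    [e_m(a / b, c) = e_m(a / b) - c e_(m-1)(a / b, c)].  At time 0 the matrix is
    triangular with inverse powers of rho on the diagonal if [nu <= lam], and
    has too large a zero block otherwise. *)

Require Import Defs.
From HB Require Import structures.
From mathcomp Require Import all_boot all_order all_algebra perm finmap.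
From mathcomp Require Import all_classical all_reals all_analysis.
From mathcomp Require Import ring zify.

Set Implicit Arguments.
Unset Strict Implicit.
Unset Printing Implicit Defensive.

Import Order.TTheory GRing.Theory Num.Theory.
Local Open Scope ring_scope.

(** * Adding one letter to elementary and complete symmetric polynomials *)

Lemma coef_prod_1DX (R : comNzRingType) (a : seq R) k :
  (\prod_(c <- a) (1 + c *: 'X))`_k = Defs.esym k a.
Proof.
rewrite (big_nth 0) big_mkord; under eq_bigr do rewrite addrC.
rewrite bigA_distr coef_sum /Defs.esym [RHS]big_mkcond /=.
apply: eq_bigr => A _.
rewrite (bigID [in A]) /= [X in _ * X]big1 ?mulr1; last first.
  by move=> i /negbTE ->.
rewrite (eq_bigr (fun i : 'I_(size a) => a`_i *: 'X)) => [|i ->//].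
rewrite scaler_prod prodr_const coefZ coefXn eq_sym.
by case: eqP; rewrite (mulr0, mulr1).
Qed.

Lemma esym0 (R : comNzRingType) (a : seq R) : Defs.esym 0 a = 1.
Proof.
rewrite /Defs.esym (big_pred1 finset.set0) ?big_set0 // => A.
by rewrite cards_eq0.
Qed.

Lemma esym_insert (R : comNzRingType) k (s a : seq R) c :
  Defs.esym k.+1 (s ++ c :: a) =
  Defs.esym k.+1 (s ++ a) + c * Defs.esym k (s ++ a).
Proof.
rewrite -!coef_prod_1DX !big_cat big_cons /= mulrCA mulrDl mul1r.
by rewrite coefD -scalerAl coefZ coefXM.
Qed.

Lemma esym_gt_size (R : comNzRingType) k (a : seq R) :
  (size a < k)%N -> Defs.esym k a = 0.
Proof.
move=> ltak; rewrite /Defs.esym big_pred0 // => A; apply/negbTE.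
rewrite neq_ltn (leq_ltn_trans _ ltak) //.
by rewrite -[X in (_ <= X)%N]card_ord max_card.
Qed.

(** The complete symmetric polynomial of degree [k] in [F h, ..., F (n - 1)], summed over weakly
    increasing chains of indices; the lower bound [h] allows peeling off the smallest index. *)
Fixpoint hchain (R : comNzRingType) (F : nat -> R) (n k h : nat) : R :=
  if k is k'.+1 then \sum_(h <= i < n) F i * hchain F n k' i else 1.

Lemma hchainE (R : comNzRingType) (F : nat -> R) n k h :
  \sum_(t : k.-tuple 'I_n | path leq h (map val t)) \prod_(i <- t) F i =
  hchain F n k h.
Proof.
elim: k h => [|k IHk] h /=.
  by rewrite (big_pred1 [tuple]) ?big_nil // => t; rewrite [t]tuple0 /= eqxx.
rewrite (reindex (fun p : 'I_n * k.-tuple 'I_n => [tuple of p.1 :: p.2])) /=.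
  rewrite (eq_bigl (fun p : 'I_n * k.-tuple 'I_n =>
    (h <= p.1)%N && path leq p.1 (map val p.2))) //.
  rewrite (eq_bigr (fun p : 'I_n * k.-tuple 'I_n =>
    F p.1 * \prod_(i <- p.2) F i)); last by move=> p _; rewrite big_cons.
  rewrite -(pair_big_dep (fun i : 'I_n => h <= i)%N
    (fun (i : 'I_n) (t : k.-tuple 'I_n) => path leq i (map val t))
    (fun i t => F i * \prod_(j <- t) F j)) /=.
  rewrite (big_nat_widenl h 0) // big_mkord; apply: eq_bigr => i _.
  by rewrite -big_distrr /= IHk.
exists (fun t => (thead t, [tuple of behead t])) => [[i t] _|t _] /=.
  by rewrite theadE; congr pair; apply: val_inj.
by rewrite -tuple_eta.
Qed.

Lemma hchain_ge (R : comNzRingType) (F : nat -> R) n k : hchain F n k.+1 n = 0.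
Proof. by rewrite /= big_geq. Qed.

(** A chain either avoids the index [n] or loses one occurrence of it. As [hchain] peels from the
    other end, this takes an induction on [k]. *)
Lemma hchainS (R : comNzRingType) (F : nat -> R) n k h : (h <= n)%N ->
  hchain F n.+1 k.+1 h = hchain F n k.+1 h + F n * hchain F n.+1 k h.
Proof.
elim: k h => [|k IHk] h lehn; first by rewrite /= big_nat_recr.
transitivity (\sum_(h <= i < n.+1)
    (F i * hchain F n k.+1 i + F n * (F i * hchain F n.+1 k i))).
  rewrite [LHS]/=; apply: eq_big_nat => i /andP[_ ltin].
  by rewrite -[X in F i * X]/(hchain F n.+1 k.+1 i) IHk // mulrDr mulrCA.
rewrite big_split -big_distrr /= (big_nat_recr n) //=.
by rewrite (big_geq (leqnn n)) mulr0 addr0.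
Qed.

Lemma eq_hchain (R : comNzRingType) (F F' : nat -> R) n k h :
  (forall i, (i < n)%N -> F i = F' i) -> hchain F n k h = hchain F' n k h.
Proof.
move=> eqF; elim: k h => //= k IHk h; apply: eq_big_nat => i /andP[_ lin].
by rewrite eqF ?IHk.
Qed.

Lemma hsymE (R : comNzRingType) k (b : seq R) :
  hsym k b = hchain (nth 0 b) (size b) k 0.
Proof.
by rewrite -hchainE; apply: eq_bigl => t /=; case: (map _ _).
Qed.

Lemma hsym0 (R : comNzRingType) (b : seq R) : hsym 0 b = 1.
Proof. by rewrite hsymE. Qed.

Lemma hsym_nil (R : comNzRingType) k : hsym k.+1 ([::] : seq R) = 0.
Proof. by rewrite hsymE hchain_ge. Qed.

Lemma hsym_rcons (R : comNzRingType) k (b : seq R) c :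
  hsym k.+1 (rcons b c) = hsym k.+1 b + c * hsym k (rcons b c).
Proof.
rewrite !hsymE size_rcons hchainS // nth_rcons ltnn eqxx; congr (_ + _).
by apply: eq_hchain => i lti; rewrite nth_rcons lti.
Qed.

(** * The supersymmetric functions e_m(a / b) *)

Lemma esuper_lt0 (R : comNzRingType) (m : int) (a b : seq R) :
  m < 0 -> esuper m a b = 0.
Proof. by case: m. Qed.

(** The generating function of e_m(a / b) is the product of the 1 + a_i z over the product of the 1
    + b_i z; a letter added to a multiplies it by 1 + c z, a letter added to b divides it. *)
Lemma esuper_insert (R : comNzRingType) (m : int) (s a b : seq R) c :
  esuper m (s ++ c :: a) b =
  esuper m (s ++ a) b + c * esuper (m - 1) (s ++ a) b.
Proof.
case: m => [[|m]|m]; last 1 first.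
- by rewrite !esuper_lt0 ?mulr0 ?addr0 //; lia.
- rewrite (@esuper_lt0 _ (_ - _)) // mulr0 addr0 /=.
  by rewrite !big_ord1 !esym0.
have -> : m.+1%:Z - 1 = m%:Z by lia.
rewrite /= big_ord_recl [X in _ = X + _]big_ord_recl !esym0 -addrA.
congr (_ + _); rewrite big_distrr -big_split; apply: eq_bigr => k _ /=.
by rewrite /bump /= add1n subSS esym_insert; ring.
Qed.

Lemma esuper_rcons (R : comNzRingType) (m : int) (a b : seq R) c :
  esuper m a (rcons b c) + c * esuper (m - 1) a (rcons b c) = esuper m a b.
Proof.
case: m => [[|m]|m]; last 1 first.
- by rewrite !esuper_lt0 ?mulr0 ?addr0 //; lia.
- rewrite (@esuper_lt0 _ (_ - _)) // mulr0 addr0 /=.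
  by rewrite !big_ord1 !hsym0.
have -> : m.+1%:Z - 1 = m%:Z by lia.
rewrite /= big_ord_recr [X in _ = X]big_ord_recr /= subnn !hsym0 addrAC.
congr (_ + _); rewrite big_distrr -big_split; apply: eq_bigr => k _ /=.
by rewrite subSn -1?ltnS // hsym_rcons exprS; ring.
Qed.

Lemma esuper_cancel (R : comNzRingType) (m : int) (a b : seq R) :
  esuper m (b ++ a) b = esuper m a [::].
Proof.
elim/last_ind: b a => [|b c IHb] a //.
by rewrite cat_rcons esuper_insert esuper_rcons IHb.
Qed.

Lemma esuper_nil (R : comNzRingType) (k : nat) (a : seq R) :
  esuper k a [::] = Defs.esym k a.
Proof.
rewrite /= big_ord_recr /= subnn hsym0 mul1r mulr1 big1 ?add0r // => i _.
by rewrite -(subnSK (ltn_ord i)) hsym_nil mulr0.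
Qed.

Lemma esuper_rcons_self (R : comNzRingType) (k : nat) (b : seq R) c :
  esuper k b (rcons b c) = (- c) ^+ k.
Proof.
elim: k => [|k IHk].
  by rewrite /= big_ord1 esym0 hsym0 !mulr1.
have := esuper_rcons k.+1%:Z b b c.
have -> : k.+1%:Z - 1 = k%:Z by lia.
(* The right-hand side e_(k+1)(b / b) cancels to e_(k+1) of the empty alphabet, which is 0. *)
rewrite IHk -{3}[b]cats0 esuper_cancel esuper_nil esym_gt_size // => /eqP.
by rewrite addr_eq0 exprS mulNr => /eqP.
Qed.

(** * Determinants: multilinearity in the rows and zero blocks *)

Lemma det_sum_rows (R : comNzRingType) l (J : finType)
    (F : 'I_l -> J -> 'I_l -> R) :
  \det (\matrix_(i, j) \sum_b F i b j) =
  \sum_(f : {ffun 'I_l -> J}) \det (\matrix_(i, j) F i (f i) j).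
Proof.
rewrite /determinant exchange_big; apply: eq_bigr => s _ /=.
rewrite -big_distrr /= ; congr (_ * _).
under eq_bigr do rewrite mxE.
rewrite bigA_distr_bigA /=; apply: eq_bigr => f _.
by apply: eq_bigr => i _; rewrite mxE.
Qed.

Lemma det_scale_rows (R : comNzRingType) l (c : 'I_l -> R)
    (A : 'I_l -> 'I_l -> R) :
  \det (\matrix_(i, j) (c i * A i j)) =
  (\prod_i c i) * \det (\matrix_(i, j) A i j).
Proof.
rewrite /determinant big_distrr; apply: eq_bigr => s _ /=.
rewrite mulrCA -big_split; congr (_ * _).
by apply: eq_bigr => i _; rewrite !mxE.
Qed.

(** Pigeonhole: there are l - k rows from [k] on but only l - k - 1 columns beyond [k], so every
    permutation meets the zero block. *)
Lemma det_zero_block (R : comNzRingType) l (A : 'M[R]_l) (k : 'I_l) :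
  (forall i j : 'I_l, (j <= k <= i)%N -> A i j = 0) -> \det A = 0.
Proof.
move=> A0; rewrite /determinant big1 // => s _.
have [i leki lesk] : exists2 i : 'I_l, (k <= i)%N & (s i <= k)%N.
  apply: contrapT => noi.
  have sub :
      [set s i | i : 'I_l & (k <= i)%N] \subset [set j : 'I_l | (k < j)%N].
    apply/fintype.subsetP => j /imsetP[i]; rewrite !inE => leki ->.
    by rewrite ltnNge; apply/negP => lesk; apply: noi; exists i.
  have := subset_leq_card sub; rewrite card_imset; last exact: perm_inj.
  apply/negP; rewrite -ltnNge; apply: proper_card; apply/fintype.properP; split.
    by apply/fintype.subsetP => i; rewrite !inE => /ltnW.
  by exists k; rewrite !inE ?leqnn ?ltnn.
by rewrite (bigD1 i) //= A0 ?lesk // mul0r mulr0.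
Qed.

(** * The determinant: recursion in time, straightening, vanishing and initial value *)

Lemma neg_invS (R : fieldType) l (rho : 'I_l -> R) (i : 'I_l) :
  neg_inv rho i.+1 = rcons (neg_inv rho i) (- (rho i)^-1).
Proof.
have lti : (i < size (enum 'I_l))%N by rewrite size_enum_ord.
rewrite /neg_inv (take_nth 0); last by rewrite size_map.
by rewrite (nth_map i) // nth_ord_enum.
Qed.

Lemma neg_inv_cat (R : fieldType) l (rho : 'I_l -> R) (i j : nat) :
  (i <= j <= l)%N ->
  exists2 s, neg_inv rho j = neg_inv rho i ++ s & size s = (j - i)%N.
Proof.
case/andP=> leij lejl; exists (drop i (neg_inv rho j)).
  by rewrite -[LHS](cat_take_drop i) /neg_inv take_takel.
rewrite size_drop size_take size_map size_enum_ord.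
by case: ltngtP lejl => // ->.
Qed.

Definition bernoulli_weight (R : fieldType) (y : R) (b : bool) : R :=
  if b then y / (1 + y) else (1 + y)^-1.

(* The bounds [kap] are strict, [G j n < kap j], so that the bound
   [lam i - 1] stays in [nat] when [lam i = 0]: [kap i] is [lam i + 1].  The
   factors in front of the determinant are distributed over the rows. *)
Definition caseD_coef (R : fieldType) l (rho : 'I_l -> R) (x : nat -> R)
    (nu : 'I_l -> nat) (n : nat) (i : 'I_l) (k : nat) : R :=
  rho i ^ (k%:Z - 1 - (nu i)%:Z) * \prod_(s < n) (1 + rho i * x s)^-1.

Definition caseD_entry (R : fieldType) l (rho : 'I_l -> R) (x : nat -> R)
    (nu : 'I_l -> nat) (n : nat) (i : 'I_l) (k : nat) (j : 'I_l) : R :=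
  caseD_coef rho x nu n i k *
  esuper (k%:Z - 1 - (nu j)%:Z + j%:Z - i%:Z)
    ([seq x s | s <- iota 0 n] ++ neg_inv rho j) (neg_inv rho i.+1).

Definition caseD_det (R : fieldType) l (rho : 'I_l -> R) (x : nat -> R)
    (nu : 'I_l -> nat) (n : nat) (kap : 'I_l -> nat) : R :=
  \det (\matrix_(i, j) caseD_entry rho x nu n i (kap i) j).

(** The letter [x n] splits the entry in two. In the second term, lowering the bound by one costs a
    factor [rho i], which joins [x n] to form the Bernoulli weight of a jump. *)
Lemma caseD_entry_step (R : fieldType) l (rho : 'I_l -> R) (x : nat -> R)
    (nu : 'I_l -> nat) n (i : 'I_l) k (j : 'I_l) : rho i != 0 -> (0 < k)%N ->
  caseD_entry rho x nu n.+1 i k j =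
  \sum_b bernoulli_weight (rho i * x n) b * caseD_entry rho x nu n i (k - b) j.
Proof.
move=> rhoi k_gt0; rewrite big_bool /= /caseD_entry /caseD_coef subn0.
rewrite -[n.+1]addn1 iotaD map_cat -catA /= esuper_insert addn1 big_ord_recr /=.
have -> : k%:Z - 1 - (nu i)%:Z = (k - 1)%N%:Z - 1 - (nu i)%:Z + 1 by lia.
have -> : k%:Z - 1 - (nu j)%:Z + j%:Z - i%:Z - 1 =
  (k - 1)%N%:Z - 1 - (nu j)%:Z + j%:Z - i%:Z by lia.
by rewrite expfzDr // expr1z add0n; ring.
Qed.

Lemma caseD_det_step (R : fieldType) l (rho : 'I_l -> R) (x : nat -> R)
    (nu : 'I_l -> nat) n (kap : 'I_l -> nat) :
  (forall i, rho i != 0) -> (forall i, 0 < kap i)%N ->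
  caseD_det rho x nu n.+1 kap =
  \sum_(b : {ffun 'I_l -> bool})
    (\prod_i bernoulli_weight (rho i * x n) (b i)) *
    caseD_det rho x nu n (fun i => kap i - b i)%N.
Proof.
move=> rho0 kap_gt0.
transitivity (\det (\matrix_(i, j) \sum_b bernoulli_weight (rho i * x n) b *
    caseD_entry rho x nu n i (kap i - b) j)).
  by congr (\det _); apply/matrixP => i j; rewrite !mxE caseD_entry_step.
rewrite (det_sum_rows (fun i (b : bool) j => bernoulli_weight (rho i * x n) b *
    caseD_entry rho x nu n i (kap i - b) j)).
by apply: eq_bigr => b _; rewrite det_scale_rows.
Qed.

Lemma caseD_coef_neq0 (R : fieldType) l (rho : 'I_l -> R) (x : nat -> R)
    (nu : 'I_l -> nat) n (i : 'I_l) k :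
  rho i != 0 -> (forall s, 1 + rho i * x s != 0) ->
  caseD_coef rho x nu n i k != 0.
Proof.
move=> rhoi xi; rewrite mulf_neq0 ?expfz_neq0 //.
by apply/prodf_neq0 => s _; rewrite invr_neq0.
Qed.

(** Row [i'] at bound [k + 1] and row [i] at bound [k] have entries of the same degree, and their
    second alphabets differ by the letter [- (rho i')^-1] only. The term of degree one less carries
    a factor [(rho i')^-1], which turns the coefficient for [k + 1] into the one for [k]. *)
Lemma caseD_entry_succ (R : fieldType) l (rho : 'I_l -> R) (x : nat -> R)
    (nu : 'I_l -> nat) n (i i' : 'I_l) k (j : 'I_l) :
    (forall i, rho i != 0) -> (forall i s, 1 + rho i * x s != 0) ->
    i' = i.+1 :> nat ->
  caseD_entry rho x nu n i' k.+1 j =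
  caseD_coef rho x nu n i' k.+1 / caseD_coef rho x nu n i k *
    caseD_entry rho x nu n i k j + caseD_entry rho x nu n i' k j.
Proof.
move=> rho0 rx0 ei'.
rewrite /caseD_entry [X in _ = X + _]mulrA divfK; last first.
  exact: caseD_coef_neq0.
rewrite neg_invS -[X in _ = _ * X + _](esuper_rcons _ _ _ (- (rho i')^-1)).
rewrite -ei'.
set a := (_ ++ _); set b := rcons _ _.
have -> : k%:Z - 1 - (nu j)%:Z + j%:Z - i%:Z =
  k.+1%:Z - 1 - (nu j)%:Z + j%:Z - i'%:Z by lia.
have -> : k.+1%:Z - 1 - (nu j)%:Z + j%:Z - i'%:Z - 1 =
  k%:Z - 1 - (nu j)%:Z + j%:Z - i'%:Z by lia.
have -> : caseD_coef rho x nu n i' k.+1 = caseD_coef rho x nu n i' k * rho i'.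
  rewrite /caseD_coef.
  have -> : k.+1%:Z - 1 - (nu i')%:Z = k%:Z - 1 - (nu i')%:Z + 1 by lia.
  by rewrite expfzDr // expr1z mulrAC.
rewrite mulrDr mulNr mulrN !mulrA mulfK // subrK //.
Qed.

(* If [kap i' = kap i + 1], row i' is the row for the bound [kap i] plus a
   multiple of row i. *)
Lemma caseD_det_straighten (R : fieldType) l (rho : 'I_l -> R) (x : nat -> R)
    (nu : 'I_l -> nat) n (kap : 'I_l -> nat) (i i' : 'I_l) :
    (forall i, rho i != 0) -> (forall i s, 1 + rho i * x s != 0) ->
    i' = i.+1 :> nat -> kap i' = (kap i).+1 ->
  caseD_det rho x nu n kap =
  caseD_det rho x nu n (fun m => if m == i' then kap i else kap m).
Proof.
move=> rho0 rx0 ei' ekap; have ii' : i == i' = false.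
  by apply/negbTE; rewrite -val_eqE /= ei' neq_ltn ltnSn.
pose B := \matrix_(p, q) if p == i' then caseD_entry rho x nu n i (kap i) q
                         else caseD_entry rho x nu n p (kap p) q.
have B0 : \det B = 0.
  apply: (@determinant_alternate _ _ _ i i'); first by rewrite ii'.
  by move=> q; rewrite !mxE eqxx ii'.
rewrite /caseD_det.
rewrite (@determinant_multilinear _ _ _ B
  (\matrix_(p, q) caseD_entry rho x nu n p (if p == i' then kap i else kap p) q)
  i' (caseD_coef rho x nu n i' (kap i).+1 / caseD_coef rho x nu n i (kap i)) 1).
- by rewrite B0 mulr0 add0r mul1r.
- by apply/rowP => q; rewrite !mxE eqxx mul1r ekap -caseD_entry_succ.
- by apply/matrixP => p q; rewrite !mxE eq_sym (negbTE (neq_lift _ _)).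
- by apply/matrixP => p q; rewrite !mxE eq_sym (negbTE (neq_lift _ _)).
Qed.

(** For j <= k <= i, kap_i <= kap_k <= nu_k <= nu_j, so the degree of the entry is negative. *)
Lemma caseD_det_eq0 (R : fieldType) l (rho : 'I_l -> R) (x : nat -> R)
    (nu : 'I_l -> nat) n (kap : 'I_l -> nat) (k : 'I_l) :
  is_partition kap -> is_partition nu -> (kap k <= nu k)%N ->
  caseD_det rho x nu n kap = 0.
Proof.
move=> hkap hnu lek.
apply: (det_zero_block (k := k)) => i j /andP[lejk leki]; rewrite mxE.
rewrite /caseD_entry esuper_lt0 ?mulr0 //.
by have := hkap _ _ leki; have := hnu _ _ lejk; lia.
Qed.

Lemma caseD_det0 (R : fieldType) l (rho : 'I_l -> R) (x : nat -> R)
    (nu kap : 'I_l -> nat) :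
  (forall i, rho i != 0) -> is_partition nu -> (forall j, nu j < kap j)%N ->
  caseD_det rho x nu 0 kap = 1.
Proof.
move=> rho0 hnu ltnk; rewrite /caseD_det det_trig; last first.
  apply/is_trig_mxP => i j ltij; rewrite mxE /caseD_entry /=.
  (* Above the diagonal the second alphabet is a prefix of the first; after cancellation j - i - 1
     letters remain, fewer than the degree. *)
  have [|s -> ss] := @neg_inv_cat _ _ rho i.+1 j; first by rewrite ltij ltnW.
  rewrite esuper_cancel.
  have := hnu _ _ (ltnW ltij); have := ltnk i => ? ?.
  have -> : (kap i)%:Z - 1 - (nu j)%:Z + j%:Z - i%:Z =
    (kap i - 1 - nu j + (j - i))%N%:Z by lia.
  by rewrite esuper_nil esym_gt_size ?mulr0 // ss; lia.
apply: big1 => i _; rewrite mxE /caseD_entry /caseD_coef big_ord0 mulr1 /=.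
rewrite neg_invS; have := ltnk i => ?.
have -> : (kap i)%:Z - 1 - (nu i)%:Z + i%:Z - i%:Z =
  (kap i - 1 - nu i)%N%:Z by lia.
have -> : (kap i)%:Z - 1 - (nu i)%:Z = (kap i - 1 - nu i)%N%:Z by lia.
by rewrite esuper_rcons_self opprK exprVn mulfV // expf_neq0.
Qed.

(** * Particle dynamics and bounds that are almost partitions *)

Lemma G_partition l (nu : 'I_l -> nat) (w : 'I_l -> nat -> bool) n :
  is_partition nu -> is_partition (fun j => G nu w j n).
Proof.
case: n => // n hnu i j leij /=; apply/bigmax_leqP => m lejm.
by apply: (bigop.bigmax_sup m) => //; apply: leq_trans lejm.
Qed.

(** The maximum defining [G j] runs over m >= j, and kap_m <= kap_j there, so the bounds on the
    pushing particles follow from their own. *)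
Lemma G_lt_step l (nu kap : 'I_l -> nat) (w : 'I_l -> nat -> bool) n :
  is_partition kap ->
  (forall j, G nu w j n.+1 < kap j)%N <->
  (forall j, G nu w j n < kap j - w j n)%N.
Proof.
move=> hkap; split=> ltG j.
  rewrite ltn_subRL addnC; apply: leq_ltn_trans (ltG j).
  exact: (bigop.bigmax_sup j).
rewrite /=; have := ltG j; case E: (kap j) => [|k] //= _.
rewrite ltnS; apply/bigmax_leqP => m lejm; rewrite -ltnS -E addnC.
by apply: leq_trans (hkap _ _ lejm); rewrite -ltn_subRL.
Qed.

Lemma partition_or_ascent l (kap : 'I_l -> nat) :
  is_partition kap \/
  exists i i' : 'I_l, i' = i.+1 :> nat /\ (kap i < kap i')%N.
Proof.
case: (pselect (exists i i' : 'I_l, i' = i.+1 :> nat /\ (kap i < kap i')%N)).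
  by right.
move=> nasc; left=> i j; elim: {j}_.+1 {-2}j (ltnSn j) => // k IHk j ltjk.
rewrite leq_eqVlt => /predU1P[/val_inj ->//|ltij].
have ltj : (j.-1 < l)%N by apply: leq_ltn_trans (ltn_ord j); lia.
apply: (@leq_trans (kap (Ordinal ltj))).
  rewrite leqNgt; apply/negP => lt; apply: nasc; exists (Ordinal ltj), j.
  by split => //=; lia.
by apply: IHk => /=; lia.
Qed.

(** Reduces a claim on near-partitions to partitions: levelling an ascent lowers the sum of [kap] by
    one and keeps every ascent, adjacent or not, at most one. *)
Lemma near_partition_ind l (Q : ('I_l -> nat) -> Prop) :
    (forall kap, is_partition kap -> Q kap) ->
    (forall (kap : 'I_l -> nat) (i i' : 'I_l),
      i' = i.+1 :> nat -> kap i' = (kap i).+1 ->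
      Q (fun m => if m == i' then kap i else kap m) -> Q kap) ->
  forall kap : 'I_l -> nat,
    (forall i j : 'I_l, (i <= j)%N -> (kap j <= (kap i).+1)%N) -> Q kap.
Proof.
move=> Qpart Qasc kap.
elim: {kap}_.+1 {-2}kap (ltnSn (\sum_m kap m)) => // s IHs kap les near.
have [/Qpart //|[i [i' [ei' lti]]]] := partition_or_ascent kap.
have ekap : kap i' = (kap i).+1.
  by apply/eqP; rewrite eqn_leq lti near // ei'.
apply: (Qasc _ i i') => //; apply: IHs => [|p q lepq].
  rewrite ltnS in les; apply: leq_trans les.
  rewrite (bigD1 i') //= [X in (_ < X)%N](bigD1 i') //=.
  rewrite eqxx ekap addSn ltnS leq_add2l leq_sum // => m /negbTE -> //.
case: (q =P i') => [eq|_]; case: (p =P i') => [ep|_] //.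
- by rewrite (leq_trans _ (near p q lepq)) // eq ekap.
- by rewrite near //; apply: leq_trans lepq; rewrite ep ei'.
- exact: near.
Qed.

(** * Events of the particle system and their probabilities *)

Local Open Scope classical_set_scope.
Local Open Scope ring_scope.

(** Besides bounding the configuration at time [n], the event prescribes the weights of the steps
    [n] to [N - 1]. This replaces conditional probabilities in the induction on [n]. *)
Definition caseD_event (T : Type) l (w : 'I_l -> nat -> T -> bool)
    (nu : 'I_l -> nat) (N n : nat) (c : nat -> 'I_l -> bool)
    (kap : 'I_l -> nat) : set T :=
  [set t | (forall j, G nu (fun m i => w m i t) j n < kap j)%N /\
           (forall i j, (n <= i < N)%N -> w j i t = c i j)].

Lemma caseD_event_straighten (T : Type) l (w : 'I_l -> nat -> T -> bool)
    (nu : 'I_l -> nat) N n c (kap : 'I_l -> nat) (i i' : 'I_l) :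
    is_partition nu -> i' = i.+1 :> nat -> kap i' = (kap i).+1 ->
  caseD_event w nu N n c kap =
  caseD_event w nu N n c (fun m => if m == i' then kap i else kap m).
Proof.
move=> hnu ei' ekap; apply/seteqP; split=> t [ltG wc]; split=> // j.
  case: eqP => [->|//]; apply: leq_ltn_trans (ltG i).
  by apply: (G_partition _ _ hnu); rewrite ei'.
have := ltG j; case: eqP => [-> ltGi|//].
by rewrite ekap ltnS ltnW.
Qed.

Lemma caseD_event_step (T : Type) l (w : 'I_l -> nat -> T -> bool)
    (nu : 'I_l -> nat) N n c (kap : 'I_l -> nat) :
    is_partition kap -> (n < N)%N ->
  caseD_event w nu N n.+1 c kap =
  \bigcup_(b in [set: {ffun 'I_l -> bool}])
    caseD_event w nu N n (fun i => if i == n then b : _ -> _ else c i)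
      (fun j => kap j - b j)%N.
Proof.
move=> hkap ltnN; apply/seteqP; split=> t.
  case=> /(G_lt_step _ _ _ hkap) ltG wc.
  exists [ffun j => w j n t] => //; split.
    by move=> j; rewrite ffunE.
  move=> i j /andP[leni ltiN].
  case: eqP => [->|/eqP neq]; first by rewrite ffunE.
  by rewrite wc // ltn_neqAle eq_sym neq leni ltiN.
case=> b _ [ltG wc]; split.
  apply/(G_lt_step _ _ _ hkap) => j; have := ltG j.
  by rewrite (wc n j) ?leqnn // eqxx.
move=> i j /andP[leni ltiN]; rewrite wc ?ltiN ?andbT ?(ltnW leni) //.
by rewrite gtn_eqF.
Qed.

Lemma measure_bigcup_finType (d : measure_display) (T : measurableType d)
    (R : realType) (P : probability T R) (I : finType) (F : I -> set T) :
    (forall i, measurable (F i)) -> trivIset setT F ->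
  P (\bigcup_(i in setT) F i) = (\sum_i P (F i))%E.
Proof.
move=> mF tF; rewrite measure_fin_bigcup //; last exact: finite_finset.
rewrite fsbig_finite; last exact: finite_finset.
apply/perm_big/uniq_perm; rewrite ?fset_uniq ?index_enum_uniq // => i.
rewrite in_fset_set ?mem_index_enum; last exact: finite_finset.
exact/mem_set.
Qed.

Lemma caseD_cylinder (R : realType) (d : measure_display)
    (T : measurableType d) (P : probability T R) l (rho : 'I_l -> R)
    (x : nat -> R) (w : 'I_l -> nat -> {RV P >-> bool})
    (hw : caseD_weights rho x w) N (c : nat -> 'I_l -> bool) :
  let C := [set t | forall i j, (i < N)%N -> w j i t = c i j] in
  measurable C /\
  P C = (\prod_(0 <= i < N) \prod_j bernoulli_weight (rho j * x i) (c i j))%:E.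
Proof.
case: hw => w1 w0 windep C.
pose s := [seq (j, i) | j <- enum 'I_l, i <- iota 0 N].
pose J := [fset ji in s]%fset.
have us : uniq s.
  by apply: allpairs_uniq => [||[? ?] [? ?]]; rewrite ?enum_uniq ?iota_uniq.
have CE : C = \bigcap_(ji in [set` J]) (w ji.1 ji.2 @^-1` [set c ji.2 ji.1]).
  apply/seteqP; split=> t.
    move=> wc [j i] /=; rewrite !inE => /allpairsP[[j' i'] /= [_ + [-> ->]]].
    by rewrite mem_iota => /wc.
  move=> wc i j ltiN; apply: (wc (j, i)) => /=; rewrite !inE.
  by apply/allpairsP; exists (j, i); rewrite mem_enum mem_iota.
split.
  rewrite CE; apply: fin_bigcap_measurable => // -[j i] _ /=.
  by rewrite -[X in measurable X]setTI; apply: measurable_funPT.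
rewrite CE (windep J (fun ji => [set c ji.2 ji.1])) //.
have wE j i : P (w j i @^-1` [set c i j]) =
    (bernoulli_weight (rho j * x i) (c i j))%:E.
  by case: (c i j); rewrite (w1, w0).
rewrite (eq_bigr _ (fun ji _ => wE ji.1 ji.2)) prodEFin; congr EFin.
rewrite (perm_big s) /=; last first.
  by apply: uniq_perm; rewrite ?fset_uniq // => ji; rewrite !inE.
rewrite big_allpairs_dep /= exchange_big /= /index_iota subn0.
by apply: eq_bigr => i _; rewrite big_enum.
Qed.

(** The bound [kap] ranges over near-partitions because the induction step passes to [kap - b];
    measurability is carried along for additivity. *)
Lemma caseD_event_prob (R : realType) (d : measure_display)
    (T : measurableType d) (P : probability T R) l (rho : 'I_l -> R)
    (x : nat -> R) (w : 'I_l -> nat -> {RV P >-> bool}) (nu : 'I_l -> nat)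
    (hw : caseD_weights rho x w) (rx : forall j i, 0 < rho j * x i)
    (hnu : is_partition nu) N n :
  (n <= N)%N -> forall (c : nat -> 'I_l -> bool) (kap : 'I_l -> nat),
  (forall i j : 'I_l, (i <= j)%N -> (kap j <= (kap i).+1)%N) ->
  let E := caseD_event (fun m i => w m i) nu N n c kap in
  measurable E /\
  P E = (caseD_det rho x nu n kap *
    \prod_(n <= i < N) \prod_j bernoulli_weight (rho j * x i) (c i j))%:E.
Proof.
have rho0 i : rho i != 0.
  by apply: contraTneq (rx i 0) => ->; rewrite mul0r ltxx.
have rx0 i s : 1 + rho i * x s != 0 by rewrite gt_eqF // addr_gt0.
(* In both cases, straightening event and determinant together leaves only genuine partitions
   [kap]. *)
elim: n => [|n IHn] lenN c;
  (apply: near_partition_ind => [kap hkap|kap i i' ei' ekap]; last by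
    rewrite /= (caseD_event_straighten _ _ _ _ hnu ei' ekap)
      (caseD_det_straighten _ _ rho0 rx0 ei' ekap)).
  case: (pselect (forall j, nu j < kap j)%N) => [ltnk|nlt].
    rewrite caseD_det0 // mul1r /=.
    have -> : caseD_event (fun m i => w m i) nu N 0 c kap =
        [set t | forall i j, (i < N)%N -> w j i t = c i j].
      by apply/seteqP; split=> t // [].
    exact: caseD_cylinder.
  have [k lek] : exists k, (kap k <= nu k)%N.
    by move/existsNP: nlt => [k /negP]; rewrite -leqNgt; exists k.
  rewrite (@caseD_det_eq0 _ _ _ _ _ _ _ k) // mul0r /=.
  have -> : caseD_event (fun m i => w m i) nu N 0 c kap = set0.
    by apply/seteqP; split=> t // -[] /(_ k) /=; rewrite ltnNge lek.
  by rewrite measure0; split.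
(* A zero bound makes the event empty and the determinant 0; otherwise [kap j - b j] is not
   truncated. *)
case: (pselect (forall j, 0 < kap j)%N) => [kap_gt0|nkap]; last first.
  have [k kap0] : exists k, kap k = 0%N.
    move/existsNP: nkap => [k /negP].
    by rewrite -leqNgt leqn0 => /eqP; exists k.
  rewrite (@caseD_det_eq0 _ _ _ _ _ _ _ k) ?kap0 // mul0r /=.
  have -> : caseD_event (fun m i => w m i) nu N n.+1 c kap = set0.
    by apply/seteqP; split=> t // -[] /(_ k) /=; rewrite kap0.
  by rewrite measure0; split.
pose F (b : {ffun 'I_l -> bool}) := caseD_event (fun m i => w m i) nu N n
  (fun i => if i == n then b : _ -> _ else c i) (fun j => kap j - b j)%N.
have FP b : measurable (F b) /\ P (F b) =
    (caseD_det rho x nu n (fun j => kap j - b j)%N *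
      (\prod_j bernoulli_weight (rho j * x n) (b j) *
       \prod_(n.+1 <= i < N) \prod_j
         bernoulli_weight (rho j * x i) (c i j)))%:E.
  have [|i j leij|mF ->] := IHn _ (fun i => if i == n then b : _ -> _ else c i)
      (fun j => kap j - b j)%N.
  - exact: ltnW.
  - by have := hkap _ _ leij; case: (b i); case: (b j) => /=; lia.
  split=> //; rewrite big_ltn // eqxx.
  congr EFin; congr (_ * (_ * _)).
  by apply: eq_big_nat => i /andP[ltni _]; rewrite gtn_eqF.
rewrite /= caseD_event_step //; split.
  by apply: fin_bigcup_measurable => // b _; case: (FP b).
rewrite measure_bigcup_finType; last 2 first.
- by move=> b; case: (FP b).
(* The events are disjoint since the weights of step [n] determine [b]. *)
- apply/trivIsetP => b b' _ _ bb'; apply/seteqP; split=> t // -[[_ wb] [_ wb']].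
  case/eqP: bb'; apply/ffunP => j; move: (wb n j) (wb' n j).
  by rewrite leqnn lenN eqxx => <- // <-.
rewrite (eq_bigr _ (fun b _ => (FP b).2)) sumEFin; congr EFin.
rewrite caseD_det_step // big_distrl; apply: eq_bigr => b _ /=.
by rewrite mulrCA mulrA.
Qed.

(** * The determinantal formula *)

Unset Implicit Arguments.

Theorem theorem6p6 (R : realType) (l : nat) (rho : 'I_l -> R) (x : nat -> R)
    (rho_x_gt0 : forall (j : 'I_l) (i : nat), 0 < rho j * x i)
    (d : measure_display) (T : measurableType d) (P : probability T R)
    (w : 'I_l -> nat -> {RV P >-> bool}) (hw : caseD_weights rho x w)
    (lam nu : 'I_l -> nat) (hlam : is_partition lam) (hnu : is_partition nu)
    (n : nat) :
  P_le w n lam nu =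
  ((\prod_(j < l) rho j ^ ((lam j)%:Z - (nu j)%:Z)) *
   (\prod_(i < l) \prod_(j < n) (1 + rho i * x j)^-1) *
   \det (\matrix_(i < l, j < l)
     esuper ((lam i)%:Z - (nu j)%:Z + j%:Z - i%:Z)
       ([seq x k | k <- iota 0 n] ++ neg_inv rho j)
       (neg_inv rho i.+1)))%:E.
Proof.
(* With [N = n] no weight is prescribed, so the constant [true] is arbitrary; [lam j + 1] turns the
   weak bound into a strict one. *)
have [|_] := caseD_event_prob hw rho_x_gt0 hnu (leqnn n) (fun _ _ => true)
    (kap := fun j => (lam j).+1).
  by move=> i j /hlam; rewrite ltnS => /leqW.
rewrite big_geq // mulr1 => PE.
transitivity (caseD_det rho x nu n (fun j => (lam j).+1))%:E.
  rewrite -PE /P_le; congr (P _); apply/seteqP; split=> t /=.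
    by move=> leG; split=> // i j; rewrite ltnNge; case: leqP.
  by case.
(* Both prefactors are products over the rows and are absorbed into them. *)
congr EFin; rewrite -big_split -det_scale_rows /caseD_det; congr (\det _).
apply/matrixP => i j; rewrite !mxE /caseD_entry /caseD_coef.
have lamE (k : nat) : (lam i).+1%:Z - 1 - k%:Z = (lam i)%:Z - k%:Z by lia.
by rewrite !lamE.
Qed.
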